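(* For all variable-free strictly positive formulas $A,B$ in the signature $\{\Diamond_n,\nabla_n:n<\omega\}$: $A\vdash B$ is provable in $\mathrm{RC}^\nabla$ if and only if $A^{\mathfrak{I}}\le_{\mathfrak{I}}B^{\mathfrak{I}}$.
   Context: $\mathrm{RC}^\nabla$ is the smallest set of sequents $A\vdash B$ between strictly positive formulas (built from variables and $\top$ by $\land$, $\Diamond_n$, $\nabla_n$) containing the following axioms and closed under the following rules and under substitution: (1) $A\vdash A$; $A\vdash\top$; $A\land B\vdash A$; $A\land B\vdash B$; from $A\vdash B$, $B\vdash C$ infer $A\vdash C$; from $A\vdash B$, $A\vdash C$ infer $A\vdash B\land C$; from $A\vdash B$ infer $aA\vdash aB$ for each modality $a$; (2) $aaA\vdash aA$ for each modality $a$; (3) for $m<n$: $\Diamond_nA\vdash\Diamond_mA$, $\Diamond_nA\land\Diamond_mB\vdash\Diamond_n(A\land\Diamond_mB)$, and the same two with $\nabla$ in place of $\Diamond$; (4) $A\vdash\nabla_nA$, $\Diamond_nA\vdash\nabla_nA$; (5) for $m\le n$: $\Diamond_m\nabla_nA\vdash\Diamond_mA$, $\nabla_n\Diamond_mA\vdash\Diamond_mA$. Ignatiev algebra: let $\ell(0)=0$ and $\ell(\beta)=\gamma$ if $\beta=\delta+\omega^\gamma$. $I$ is the set of $\omega$-sequences $\vec\alpha=(\alpha_0,\alpha_1,\dots)$ of ordinals $<\varepsilon_0$ with $\alpha_{i+1}\le\ell(\alpha_i)$ for all $i$. Order: $\vec\alpha\le_{\mathfrak{I}}\vec\beta$ iff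 $\alpha_i\ge\beta_i$ for all $i$. $(I,\le_{\mathfrak{I}})$ is a meet-semilattice; $\vec\alpha\land_{\mathfrak{I}}\vec\beta$ is the greatest element of $I$ below both. Operations: $\nabla_n(\vec\alpha)=(\alpha_0,\dots,\alpha_n,0,0,\dots)$; $\Diamond_n(\vec\alpha)=(\beta_0,\dots,\beta_n,0,\dots)$ where $\beta_{n+1}=0$ and $\beta_i=\alpha_i+\omega^{\beta_{i+1}}$ for $i\le n$. The value $A^{\mathfrak{I}}$ of a variable-free formula is defined recursively: $\top^{\mathfrak{I}}=(0,0,\dots)$, $(A\land B)^{\mathfrak{I}}=A^{\mathfrak{I}}\land_{\mathfrak{I}}B^{\mathfrak{I}}$, $(\Diamond_nA)^{\mathfrak{I}}=\Diamond_n(A^{\mathfrak{I}})$, $(\nabla_nA)^{\mathfrak{I}}=\nabla_n(A^{\mathfrak{I}})$. *)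

(* Defs.v *)
From HB Require Import structures.
From mathcomp Require Export all_boot all_order.
Set Implicit Arguments.
Unset Strict Implicit.
Unset Printing Implicit Defensive.
Import Order.TTheory.
Local Open Scope order_scope.

(* Ordinals below epsilon_0, as Cantor normal forms:                          *)
(* [CW a b] stands for omega^a + b, and [nf] requires the exponents to be     *)
(* non-increasing, hereditarily.                                              *)
Inductive cnf := C0 | CW of cnf & cnf.

Fixpoint cnf_encode (x : cnf) : GenTree.tree unit :=
  if x is CW a b then GenTree.Node 0 [:: cnf_encode a; cnf_encode b]
  else GenTree.Leaf tt.

Fixpoint cnf_decode (t : GenTree.tree unit) : cnf :=
  if t is GenTree.Node _ [:: a; b] then CW (cnf_decode a) (cnf_decode b) else C0.

Lemma cnf_encodeK : cancel cnf_encode cnf_decode.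
Proof. by elim=> //= a -> b ->. Qed.

HB.instance Definition _ := Countable.copy cnf (can_type cnf_encodeK).

Lemma eq_CW a b c d : (CW a b == CW c d) = (a == c) && (b == d).
Proof.
by apply/eqP/andP => [[-> ->]|[/eqP -> /eqP ->]]; rewrite ?eqxx.
Qed.

Fixpoint cnf_lt (x y : cnf) : bool :=
  match x, y with
  | _, C0 => false
  | C0, CW _ _ => true
  | CW a b, CW c d => cnf_lt a c || (a == c) && cnf_lt b d
  end.

Lemma cnf_lt_irr : irreflexive cnf_lt.
Proof. by elim=> //= a -> b ->; rewrite andbF. Qed.

Lemma cnf_lt_trans : transitive cnf_lt.
Proof.
elim=> [|a IHa b IHb] [|a1 b1] [|a2 b2] //=.
case/orP=> [lt1|/andP[/eqP-> lt1]] /orP[lt2|/andP[/eqP<- lt2]].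
- by rewrite (IHa _ _ lt1 lt2).
- by rewrite lt1.
- by rewrite lt2.
- by rewrite eqxx (IHb _ _ lt1 lt2) orbT.
Qed.

Lemma cnf_lt_total x y : x != y -> cnf_lt x y || cnf_lt y x.
Proof.
elim: x y => [|a IHa b IHb] [|c d] //=.
rewrite eq_CW negb_and; case: (eqVneq a c) => [<-|/IHa] /=.
  by move/IHb; rewrite cnf_lt_irr.
by case/orP=> -> //=; rewrite orbT.
Qed.

Fact ord_display : Order.disp_t. Proof. exact: (Order.Disp tt tt). Qed.

HB.instance Definition _ := Order.LtOrder.Build ord_display cnf
  (fun _ _ => erefl) (fun _ _ => erefl) (fun _ _ => erefl)
  cnf_lt_irr cnf_lt_trans cnf_lt_total.

Lemma cnf_ltE (x y : cnf) : (x < y) = cnf_lt x y. Proof. by []. Qed.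

Lemma cnf_leE (x y : cnf) : (x <= y) = (x == y) || cnf_lt x y.
Proof. by []. Qed.

Lemma le0c x : C0 <= x. Proof. by case: x. Qed.

Lemma lec0 x : (x <= C0) = (x == C0). Proof. by case: x. Qed.

Lemma le_CW a b c d : (CW a b <= CW c d) = (a < c) || (a == c) && (b <= d).
Proof.
rewrite !cnf_leE cnf_ltE eq_CW /=; case: (a == c) => //=.
by case: (cnf_lt a c); rewrite ?orbT.
Qed.

Definition lead (x : cnf) : cnf := if x is CW a _ then a else C0.

Fixpoint nf (x : cnf) : bool :=
  if x is CW a b then [&& nf a, nf b & (b == C0) || (lead b <= a)] else true.

(* A term omega^a is absorbed by y as soon as a < lead y.                     *)
Fixpoint cnf_add (x y : cnf) : cnf :=
  if x is CW a b then
    if (y != C0) && (a < lead y) then y else CW a (cnf_add b y)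
  else y.

Fixpoint cnf_ell (x : cnf) : cnf :=
  match x with
  | C0 => C0
  | CW a C0 => a
  | CW _ b => cnf_ell b
  end.

Lemma nf_CW a b : nf (CW a b) = [&& nf a, nf b & lead b <= a].
Proof. by rewrite /=; case: b => //=; rewrite le0c. Qed.

Lemma cnf_lead_add x y : lead (cnf_add x y) = Order.max (lead x) (lead y).
Proof.
case: x => [|a b] /=; first by rewrite max_r // le0c.
case: ltP => [/= lt_ay|]; last by rewrite andbF.
rewrite (_ : y != C0) //; by case: y lt_ay => //=; rewrite lt_neqAle lec0 andNb.
Qed.

Lemma nf_add x y : nf x -> nf y -> nf (cnf_add x y).
Proof.
elim: x => // a _ b IHb; rewrite nf_CW => /and3P[nfa nfb le_ba] nfy.
rewrite /=; case: ifPn => // Hy; rewrite -/(nf (CW a _)) nf_CW nfa IHb //=.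
rewrite cnf_lead_add ge_max le_ba /=.
by move: Hy; rewrite negb_and negbK -leNgt => /orP[/eqP->|//]; rewrite le0c.
Qed.

Lemma nf_ell x : nf x -> nf (cnf_ell x).
Proof.
elim: x => // a _ b IHb; rewrite nf_CW => /and3P[nfa nfb _].
by case: b nfb IHb => // c d nfb; apply.
Qed.

Record eps0 := Eps0 { cnf_of :> cnf; _ : nf cnf_of }.

HB.instance Definition _ := [isSub for cnf_of].
HB.instance Definition _ := [Countable of eps0 by <:].
HB.instance Definition _ := [SubChoice_isSubOrder of eps0 by <: with ord_display].

Definition eps0_zero : eps0 := @Eps0 C0 isT.

Lemma nf_omega (a : eps0) : nf (CW a C0).
Proof. by rewrite nf_CW (valP a) le0c. Qed.

Definition omega_pow (a : eps0) : eps0 := Eps0 (nf_omega a).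

Definition ord_add (a b : eps0) : eps0 := Eps0 (nf_add (valP a) (valP b)).

Definition ell (a : eps0) : eps0 := Eps0 (nf_ell (valP a)).

Lemma le_eps0E (a b : eps0) : (a <= b) = (cnf_of a <= cnf_of b).
Proof. by []. Qed.

Lemma le0e a : eps0_zero <= a. Proof. by rewrite le_eps0E le0c. Qed.

(* [ell0], [ell_add] and [ell_decomp] characterize [ell]: ell 0 = 0 and       *)
(* ell (d + omega^c) = c, every nonzero ordinal being of the latter form.     *)
Lemma ell0 : ell eps0_zero = eps0_zero. Proof. exact: val_inj. Qed.

Lemma ell_add (d c : eps0) : ell (ord_add d (omega_pow c)) = c.
Proof.
apply: val_inj => /=; elim: (cnf_of d) => // a _ b IHb /=.
case: ifP => // _ /=.
by case E: (cnf_add b _) IHb => // IHb; case: b E => //= ? ?; case: ifP.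
Qed.

Lemma ell_decomp b : b != eps0_zero ->
  exists d, b = ord_add d (omega_pow (ell b)).
Proof.
case: b => x nfx nz_b.
suff [y nfy Dx] : exists2 y, nf y & x = cnf_add y (CW (cnf_ell x) C0).
  by exists (Eps0 nfy); apply: val_inj.
have {nz_b}: x != C0 := nz_b.
elim: x nfx => // a _ b IHb; rewrite nf_CW => /and3P[nfa nfb le_ba] _.
case: b nfb le_ba IHb => [|c d] nfb le_ca IHb; first by exists C0.
have [y nfy] := IHb nfb isT.
change (cnf_ell (CW a (CW c d))) with (cnf_ell (CW c d)).
move: (cnf_ell _) => e Dy.
have Dl := congr1 lead Dy; rewrite cnf_lead_add [lead (CW e _)]/= in Dl.
have le_ya : lead y <= a by apply: le_trans le_ca; rewrite Dl le_max lexx.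
have le_ea : e <= a by apply: le_trans le_ca; rewrite Dl le_max lexx orbT.
exists (CW a y); first by rewrite nf_CW nfa nfy.
by rewrite /= ltNge le_ea /= -Dy.
Qed.

Record ignatiev := Ignatiev {
  iseq :> nat -> eps0;
  ignatievP : forall i, iseq i.+1 <= ell (iseq i)
}.

(* The order is the reverse of the pointwise one.                             *)
Definition ile (x y : ignatiev) : Prop := forall i, y i <= x i.

Definition is_imeet (x y z : ignatiev) : Prop :=
  [/\ ile z x, ile z y & forall t, ile t x -> ile t y -> ile t z].

(* Existence of meets. The i-th component of the meet is the least ordinal    *)
(* above both i-th components whose [ell] is at least the (i+1)-st component  *)
(* of the meet; [cnf_up] computes this ordinal.                               *)
Fixpoint cnf_height (x : cnf) : nat :=
  if x is CW a _ then (cnf_height a).+1 else 0.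

Lemma cnf_height_mono (x y : cnf) :
  x <= y -> (cnf_height x <= cnf_height y)%N.
Proof.
elim: x y => // a IHa b _ [|c d] //; rewrite le_CW => /orP[/ltW|/andP[/eqP-> _]] //=.
by move/IHa.
Qed.

Lemma cnf_height_ell (x : cnf) :
  nf x -> (cnf_height (cnf_ell x) <= (cnf_height x).-1)%N.
Proof.
elim: x => // a _ b IHb; rewrite nf_CW => /and3P[_ nfb le_ba].
case: b nfb le_ba IHb => // c d nfb /= le_ca IHb.
exact: leq_trans (IHb nfb) (cnf_height_mono le_ca).
Qed.

Lemma ignatiev_height (x : ignatiev) i :
  (cnf_height (x i) <= cnf_height (x 0%N) - i)%N.
Proof.
elim: i => [|i IHi]; first by rewrite subn0.
apply: leq_trans (cnf_height_mono (ignatievP x i)) _.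
apply: leq_trans (cnf_height_ell (valP (x i))) _.
by rewrite subnS -!subn1 leq_sub2r.
Qed.

Lemma ignatiev_eq0 (x : ignatiev) i :
  (cnf_height (x 0%N) <= i)%N -> x i = eps0_zero.
Proof.
move=> le_i; apply: val_inj; move: (ignatiev_height x i).
by rewrite (eqP le_i) leqn0 /=; case: (cnf_of (x i)).
Qed.

Fixpoint cnf_up_tail (e x : cnf) : cnf :=
  if x is CW a b then
    if e <= a then CW a (cnf_up_tail e b) else CW e C0
  else C0.

Definition cnf_up (e x : cnf) : cnf :=
  if e == C0 then x else if x == C0 then CW e C0 else cnf_up_tail e x.

Lemma cnf_up_tail_lead e x : lead (cnf_up_tail e x) <= Order.max e (lead x).
Proof.
case: x => [|a b] /=; first by rewrite le0c.
by case: (leP e a) => _; apply: lexx.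
Qed.

Lemma nf_up_tail e x : nf e -> nf x -> nf (cnf_up_tail e x).
Proof.
move=> nfe; elim: x => // a _ b IHb; rewrite nf_CW => /and3P[nfa nfb le_ba] /=.
case: ifP => le_ea; last by rewrite -/(nf (CW e C0)) nf_CW nfe le0c.
rewrite -/(nf (CW _ _)) nf_CW nfa IHb //=.
by apply: le_trans (cnf_up_tail_lead _ _) _; rewrite ge_max le_ea.
Qed.

Lemma nf_up e x : nf e -> nf x -> nf (cnf_up e x).
Proof.
move=> nfe nfx; rewrite /cnf_up; case: ifP => // _; case: ifP => _.
  by rewrite nf_CW nfe le0c.
exact: nf_up_tail.
Qed.

Lemma cnf_up_tail_ge e x : x <= cnf_up_tail e x.
Proof.
elim: x => // a _ b IHb /=; case: (leP e a) => [_|lt_ae]; rewrite le_CW.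
  by rewrite eqxx IHb orbT.
by rewrite lt_ae.
Qed.

Lemma cnf_up_ge e x : x <= cnf_up e x.
Proof.
rewrite /cnf_up; case: ifP => // _; case: eqP => [->|_]; first exact: le0c.
exact: cnf_up_tail_ge.
Qed.

Lemma cnf_up_tail_ell e x : x != C0 -> e <= cnf_ell (cnf_up_tail e x).
Proof.
elim: x => // a _ b IHb _ /=; case: ifP => //= le_ea.
by case: b IHb => // c d /(_ isT); case E: (cnf_up_tail _ _) => [|u v] // _;
  move: E => /=; case: ifP.
Qed.

Lemma cnf_up_ell e x : e <= cnf_ell (cnf_up e x).
Proof.
rewrite /cnf_up; case: eqP => [->|_]; first exact: le0c.
by case: eqP => [//|/eqP]; apply: cnf_up_tail_ell.
Qed.

Lemma cnf_ell_lead x : nf x -> cnf_ell x <= lead x.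
Proof.
elim: x => // a _ b IHb; rewrite nf_CW => /and3P[_ nfb le_ba].
by case: b nfb le_ba IHb => // c d nfb le_ca IHb; apply: le_trans (IHb nfb) le_ca.
Qed.

Lemma cnf_up_tail_min e x y :
  nf y -> x <= y -> (y == C0) || (e <= cnf_ell y) -> cnf_up_tail e x <= y.
Proof.
elim: x y => [|a _ b IHb] y nfy; first by rewrite le0c.
case: y nfy => [|c d] nfy le_xy //=; rewrite -/(cnf_ell (CW c d)) => le_e.
have le_ec : e <= c := le_trans le_e (cnf_ell_lead nfy).
move: (nfy); rewrite nf_CW => /and3P[_ nfd _].
case: (leP e a) => [le_ea|lt_ae]; rewrite le_CW; last first.
  by move: le_ec; rewrite le_eqVlt => /orP[->|->] //; rewrite le0c orbT.
move: le_xy; rewrite le_CW => /orP[->//|/andP[-> le_bd]].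
rewrite IHb ?orbT //.
by case: d le_e {nfy nfd le_bd} => //= ? ?; move->; rewrite orbT.
Qed.

Lemma cnf_up_min e x y : nf y -> x <= y -> e <= cnf_ell y -> cnf_up e x <= y.
Proof.
move=> nfy le_xy le_ey; rewrite /cnf_up; case: eqVneq => // nz_e.
have nz_y : y != C0 by apply: contraNneq nz_e => y0; move: le_ey; rewrite y0 lec0.
case: ifP => _; last by apply: cnf_up_tail_min; rewrite // le_ey orbT.
move: (cnf_ell_lead nfy); case: y nz_y {le_xy nfy} le_ey => // c d _ le_e le_l.
rewrite le_CW; move: (le_trans le_e le_l) => /=.
by rewrite le_eqVlt => /orP[->|->] //; rewrite le0c orbT.
Qed.

Definition ord_up (e a : eps0) : eps0 := Eps0 (nf_up (valP e) (valP a)).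

Fixpoint imeet_aux (x y : ignatiev) (k i : nat) : eps0 :=
  if k is k'.+1 then ord_up (imeet_aux x y k' i.+1) (Order.max (x i) (y i))
  else eps0_zero.

Lemma imeet_ex (x y : ignatiev) : {z | is_imeet x y z}.
Proof.
pose N := maxn (cnf_height (x 0%N)) (cnf_height (y 0%N)).
pose s i := imeet_aux x y (N - i) i.
have sS i : (i < N)%N -> s i = ord_up (s i.+1) (Order.max (x i) (y i)).
  by move=> lt_iN; rewrite /s -(subnSK lt_iN).
have sN i : (N <= i)%N -> s i = eps0_zero by rewrite /s -subn_eq0 => /eqP->.
have sP i : s i.+1 <= ell (s i).
  case: (ltnP i N) => [/sS->|le_Ni]; first exact: cnf_up_ell.
  by rewrite sN ?le0e // ltnW.
have ge_s i : Order.max (x i) (y i) <= s i.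
  case: (ltnP i N) => [/sS->|]; first by rewrite le_eps0E; apply: cnf_up_ge.
  rewrite geq_max => /andP[lex ley].
  by rewrite (ignatiev_eq0 lex) (ignatiev_eq0 ley) maxxx le0e.
exists (Ignatiev sP); split=> [i|i|t le_tx le_ty i] /=.
- by apply: le_trans (ge_s i); rewrite le_max lexx.
- by apply: le_trans (ge_s i); rewrite le_max lexx orbT.
have [k] := ubnP (N - i); elim: k i => // k IHk i lt_k.
case: (ltnP i N) => [lt_iN|/sN->]; last exact: le0e.
rewrite (sS _ lt_iN); apply: cnf_up_min (valP (t i)) _ _.
  by rewrite -le_eps0E ge_max le_tx le_ty.
apply: (le_trans (_ : s i.+1 <= t i.+1)) (ignatievP t i).
by apply: IHk; move: lt_k; rewrite -(subnSK lt_iN).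
Qed.

(* Only the specification [imeetP] matters: it determines the sequence        *)
(* [imeet x y] componentwise, by antisymmetry of the order on ordinals.       *)
Definition imeet (x y : ignatiev) : ignatiev := sval (imeet_ex x y).

Lemma imeetP x y : is_imeet x y (imeet x y).
Proof. exact: svalP. Qed.

Definition itop : ignatiev := Ignatiev (fun i : nat => le0e (ell eps0_zero)).

Definition inabla_seq (n : nat) (x : nat -> eps0) (i : nat) : eps0 :=
  if (i <= n)%N then x i else eps0_zero.

Lemma inabla_subproof n (x : ignatiev) i :
  inabla_seq n x i.+1 <= ell (inabla_seq n x i).
Proof.
rewrite /inabla_seq; case: ltnP => [lt_in|_]; last exact: le0e.
by rewrite ltnW // ignatievP.
Qed.

Definition inabla (n : nat) (x : ignatiev) : ignatiev :=
  Ignatiev (inabla_subproof n x).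

Fixpoint idia_aux (x : nat -> eps0) (k i : nat) : eps0 :=
  if k is k'.+1 then ord_add (x i) (omega_pow (idia_aux x k' i.+1)) else eps0_zero.

(* This is beta_i; the recursion is downwards from beta_(n+1) = 0, see the    *)
(* two equations below.                                                       *)
Definition idia_seq (n : nat) (x : nat -> eps0) (i : nat) : eps0 :=
  idia_aux x (n.+1 - i) i.

Lemma idia_seq0 n x i : (n < i)%N -> idia_seq n x i = eps0_zero.
Proof. by rewrite /idia_seq -subn_eq0 => /eqP->. Qed.

Lemma idia_seqE n x i : (i <= n)%N ->
  idia_seq n x i = ord_add (x i) (omega_pow (idia_seq n x i.+1)).
Proof. by move=> le_in; rewrite /idia_seq subSn. Qed.

Lemma idia_subproof n (x : ignatiev) i :
  idia_seq n x i.+1 <= ell (idia_seq n x i).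
Proof.
case: (leqP i n) => [le_in|lt_ni]; first by rewrite (idia_seqE _ le_in) ell_add.
by rewrite idia_seq0 ?le0e // ltnW.
Qed.

Definition idia (n : nat) (x : ignatiev) : ignatiev :=
  Ignatiev (idia_subproof n x).

Inductive modality := Dia of nat | Nabla of nat.

Inductive form :=
  | Var of nat
  | Top
  | And of form & form
  | Mod of modality & form.

Declare Scope rc_scope.
Delimit Scope rc_scope with rc.
Bind Scope rc_scope with form.
Notation "A ∧ B" := (And A B)
  (at level 40, left associativity) : rc_scope.
Notation "◊[ n ] A" := (Mod (Dia n) A)
  (at level 30, right associativity, format "◊[ n ] A") : rc_scope.
Notation "∇[ n ] A" := (Mod (Nabla n) A)
  (at level 30, right associativity, format "∇[ n ] A") : rc_scope.

Fixpoint form_subst (s : nat -> form) (A : form) : form :=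
  match A with
  | Var p => s p
  | Top => Top
  | And A B => And (form_subst s A) (form_subst s B)
  | Mod a A => Mod a (form_subst s A)
  end.

Fixpoint variable_free (A : form) : bool :=
  match A with
  | Var _ => false
  | Top => true
  | And A B => variable_free A && variable_free B
  | Mod _ A => variable_free A
  end.

Reserved Notation "A ⊢ B" (at level 70, no associativity).

Inductive RCnabla : form -> form -> Prop :=
  | RC_refl A : A ⊢ A
  | RC_top A : A ⊢ Top
  | RC_andl A B : (A ∧ B)%rc ⊢ A
  | RC_andr A B : (A ∧ B)%rc ⊢ B
  | RC_trans A B C : A ⊢ B -> B ⊢ C -> A ⊢ C
  | RC_and A B C : A ⊢ B -> A ⊢ C -> A ⊢ (B ∧ C)%rc
  | RC_mod a A B : A ⊢ B -> Mod a A ⊢ Mod a B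
  | RC_subst s A B : A ⊢ B -> form_subst s A ⊢ form_subst s B
  | RC_4 a A : Mod a (Mod a A) ⊢ Mod a A
  | RC_dia_le m n A : (m < n)%N -> (◊[n] A)%rc ⊢ (◊[m] A)%rc
  | RC_dia_and m n A B : (m < n)%N ->
      (◊[n] A ∧ ◊[m] B)%rc ⊢ (◊[n] (A ∧ ◊[m] B))%rc
  | RC_nabla_le m n A : (m < n)%N -> (∇[n] A)%rc ⊢ (∇[m] A)%rc
  | RC_nabla_and m n A B : (m < n)%N ->
      (∇[n] A ∧ ∇[m] B)%rc ⊢ (∇[n] (A ∧ ∇[m] B))%rc
  | RC_nabla n A : A ⊢ (∇[n] A)%rc
  | RC_dia_nabla n A : (◊[n] A)%rc ⊢ (∇[n] A)%rc
  | RC_dia_of_nabla m n A : (m <= n)%N -> (◊[m] ∇[n] A)%rc ⊢ (◊[m] A)%rc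
  | RC_nabla_of_dia m n A : (m <= n)%N -> (∇[n] ◊[m] A)%rc ⊢ (◊[m] A)%rc
where "A ⊢ B" := (RCnabla A B).

Definition imod (a : modality) : ignatiev -> ignatiev :=
  match a with Dia n => idia n | Nabla n => inabla n end.

(* Meaningful for variable-free formulas only: variables get a dummy value.   *)
Fixpoint value (A : form) : ignatiev :=
  match A with
  | Var _ => itop
  | Top => itop
  | And A B => imeet (value A) (value B)
  | Mod a A => imod a (value A)
  end.

(* Main.v *)
(* A variable-free formula A is equivalent to the conjunction of the formulas *)
(* ∇_i F_i(a_i), where a is the value of A and F_i(x), for an ordinal x in    *)
(* Cantor normal form, is the worm in the modalities ◊_i, ◊_(i+1), ... given  *)
(* by F_i(0) = Top and F_i(d + omega^e) = F_(i+1)(e) /\ ◊_i F_i(d). Since     *)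
(* F_i(x) proves ◊_i F_i(y) for y < x, the formula ∇_i F_i(x) is monotone in  *)
(* x, so completeness follows from the equivalence, which is obtained by      *)
(* induction on A. In the soundness half the meets are handled through their  *)
(* components: the i-th one is the least ordinal above both i-th components   *)
(* whose ell is at least the (i+1)-st component of the meet.                  *)

Require Import Defs.
Set Implicit Arguments.
Unset Strict Implicit.
Unset Printing Implicit Defensive.
Import Order.TTheory.
Local Open Scope order_scope.

(** * Ordinal arithmetic *)

(** Soundness rests on one fact: d + ω^e is the least ordinal above d whose [ell] is at least e. So
    the components of ◊_n and of meets are least solutions of constraints on [ell], and inequalities
    between them are proved from high indices down to low ones. The delicate axiom is the one moving
    ◊_m under ◊_n ([idia_meet]). For completeness, [derives_value] shows that A proves every
    component formula [comp_form i] of its value, and [value_derives] that finitely many of these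
    prove A back; [comp_form_mono] turns the inequality of values into derivability between
    component formulas. *)

Lemma cnf_lt_add_omega (x e : cnf) : x < cnf_add x (CW e C0).
Proof.
elim: x => // a _ b IHb /=; case: (ltP a e) => [lt_ae|_]; rewrite cnf_ltE /=.
  by rewrite -cnf_ltE lt_ae.
by rewrite eqxx -[cnf_lt b _]cnf_ltE IHb orbT.
Qed.

(** This is the minimality half of the description of x + ω^e; [cnf_lt_add_omega] and [ell_add] show
    that it meets the two constraints. *)
Lemma cnf_add_omega_le (x e z : cnf) :
  nf z -> x < z -> e <= cnf_ell z -> cnf_add x (CW e C0) <= z.
Proof.
move=> + + le_ez.
have le_omega y : nf y -> C0 < y -> e <= cnf_ell y -> CW e C0 <= y.
  case: y => // c d nf_y _ le_ey; rewrite le_CW le0c andbT orbC -le_eqVlt.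
  exact: le_trans le_ey (cnf_ell_lead nf_y).
elim: x z le_ez => [|a _ b IHb] z le_ez nf_z lt_xz; first exact: le_omega.
have nz_z : C0 < z by case: z lt_xz {le_ez nf_z}.
rewrite /=; case: (ltP a e) => _ /=; first exact: le_omega.
case: z lt_xz nz_z nf_z le_ez => // c d lt_xz _ nf_z le_ez; rewrite le_CW.
move: lt_xz; rewrite cnf_ltE /= -2!cnf_ltE.
case/orP=> [->//|/andP[-> lt_bd]]; apply/orP; right.
move: nf_z; rewrite nf_CW => /and3P[_ nf_d _].
by apply: IHb => //; case: d lt_bd le_ez {nf_d} => //; rewrite ltNge le0c.
Qed.

Lemma lt_add_omega (a e : eps0) : a < ord_add a (omega_pow e).
Proof. exact: cnf_lt_add_omega. Qed.

Lemma add_omega_le (a e b : eps0) :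
  a < b -> e <= ell b -> ord_add a (omega_pow e) <= b.
Proof. exact: cnf_add_omega_le (valP b). Qed.

Lemma add_omega_mono (a b e f : eps0) : a <= b -> e <= f ->
  ord_add a (omega_pow e) <= ord_add b (omega_pow f).
Proof.
move=> le_ab le_ef; apply: add_omega_le; last by rewrite ell_add.
exact: le_lt_trans le_ab (lt_add_omega b f).
Qed.

Lemma add_omega_lt (a e f : eps0) : e < f ->
  ord_add a (omega_pow e) < ord_add a (omega_pow f).
Proof.
move=> lt_ef; rewrite lt_neqAle (add_omega_mono (lexx a) (ltW lt_ef)) andbT.
by apply: contraTneq lt_ef => /(congr1 ell); rewrite !ell_add => ->; rewrite ltxx.
Qed.

(** * Soundness *)

Lemma down_ind (P : nat -> Prop) N :
  (forall i, (N <= i)%N -> P i) -> (forall i, (i < N)%N -> P i.+1 -> P i) ->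
  forall i, P i.
Proof.
move=> PN PS i; have [k] := ubnP (N - i); elim: k i => // k IHk i lt_k.
case: (ltnP i N) => [lt_iN|]; last exact: PN.
apply: (PS _ lt_iN).
by apply: IHk; move: lt_k; rewrite -(subnSK lt_iN).
Qed.

Lemma ile_refl x : ile x x. Proof. by move=> i. Qed.

Lemma ile_trans x y z : ile x y -> ile y z -> ile x z.
Proof. by move=> le_xy le_yz i; apply: le_trans (le_yz i) (le_xy i). Qed.

Lemma imeet_l x y : ile (imeet x y) x. Proof. by case: (imeetP x y). Qed.

Lemma imeet_r x y : ile (imeet x y) y. Proof. by case: (imeetP x y). Qed.

Lemma imeet_glb x y t : ile t x -> ile t y -> ile t (imeet x y).
Proof. by case: (imeetP x y) => _ _; apply. Qed.

(* Lowering one component of the meet to [v] would again give a lower bound.  *)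
Lemma imeet_min (x y : ignatiev) i v : x i <= v -> y i <= v ->
  imeet x y i.+1 <= ell v -> imeet x y i <= v.
Proof.
set w := imeet x y => le_xv le_yv le_wv; rewrite leNgt; apply/negP => lt_vw.
pose s j := if j == i then v else w j.
have sP j : s j.+1 <= ell (s j).
  rewrite /s; case: (eqVneq j i) => [->|_]; first by rewrite gtn_eqF.
  case: eqP => [ji|_]; last exact: ignatievP.
  by apply: le_trans (ignatievP w j); rewrite ji ltW.
have: ile (Ignatiev sP) w.
  apply: imeet_glb => j; rewrite /= /s; case: eqP => [->//|_].
    exact: imeet_l.
  exact: imeet_r.
by move/(_ i); rewrite /= /s eqxx leNgt lt_vw.
Qed.

(** Above [m] only [x] bounds the meet from below, and [x] already satisfies the [ell] constraint,
    so [imeet_min] applies all the way down. *)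
Lemma imeet_tail (x y : ignatiev) m :
  (forall i, (m < i)%N -> y i = eps0_zero) ->
  forall i, (m < i)%N -> imeet x y i <= x i.
Proof.
move=> y0; set w := imeet x y.
apply: (@down_ind _ (cnf_height (w 0%N))) => i.
  by move=> le_i _; rewrite ignatiev_eq0 ?le0e.
move=> _ IHi lt_mi; apply: imeet_min => //; first by rewrite y0 ?le0e.
exact: le_trans (IHi (ltnW lt_mi)) (ignatievP x i).
Qed.

(** * The operations of the algebra and the axioms *)

Lemma idia_gt n (x : ignatiev) i : (i <= n)%N -> x i < idia n x i.
Proof. by move=> le_in; rewrite /= idia_seqE // lt_add_omega. Qed.

Lemma idia_mono n x y : ile x y -> ile (idia n x) (idia n y).
Proof.
move=> le_xy; apply: (@down_ind _ n.+1) => i /=; rewrite ?ltnS => lei.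
  by rewrite !idia_seq0.
by move=> IHi; rewrite !(idia_seqE _ lei) add_omega_mono.
Qed.

Lemma inabla_mono n x y : ile x y -> ile (inabla n x) (inabla n y).
Proof. by move=> le_xy i; rewrite /= /inabla_seq; case: ifP. Qed.

Lemma imod_mono a x y : ile x y -> ile (imod a x) (imod a y).
Proof. by case: a => n; [apply: idia_mono | apply: inabla_mono]. Qed.

Lemma idia_nabla n x : ile (idia n x) (inabla n x).
Proof.
move=> i; rewrite /= /inabla_seq; case: ifP => [le_in|_]; last exact: le0e.
exact/ltW/idia_gt.
Qed.

Lemma idia_le_index m n x : (m <= n)%N -> ile (idia n x) (idia m x).
Proof.
move=> le_mn; apply: (@down_ind _ m.+1) => i /=; rewrite ?ltnS => lei.
  by rewrite idia_seq0 ?le0e.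
move=> IHi; rewrite (idia_seqE _ lei) (idia_seqE _ (leq_trans lei le_mn)).
exact: add_omega_mono.
Qed.

Lemma idia_idem n x : ile (idia n (idia n x)) (idia n x).
Proof.
move=> i; case: (leqP i n) => [le_in|lt_ni]; last by rewrite /= !idia_seq0.
exact/ltW/idia_gt.
Qed.

Lemma idia_of_nabla m n x : (m <= n)%N -> ile (idia m (inabla n x)) (idia m x).
Proof.
move=> le_mn; apply: (@down_ind _ m.+1) => i /=; rewrite ?ltnS => lei.
  by rewrite !idia_seq0.
move=> IHi; rewrite !(idia_seqE _ lei) add_omega_mono //.
by rewrite /= /inabla_seq (leq_trans _ le_mn).
Qed.

(** A strict inequality [w i < z i] up to [n] is enough: [z] satisfies the [ell] constraints, so
    [add_omega_le] then bounds the components of ◊_n [w]. *)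
Lemma idia_meet m n x y : (m < n)%N ->
  ile (imeet (idia n x) (idia m y)) (idia n (imeet x (idia m y))).
Proof.
move=> lt_mn; set z := imeet _ _; set w := imeet _ _.
have le_wx i : (m < i)%N -> w i <= x i.
  by apply: imeet_tail => j; apply: idia_seq0.
have lt_xz i : (i <= n)%N -> x i < z i.
  by move=> le_in; apply: lt_le_trans (idia_gt _ le_in) (imeet_l _ _ i).
have lt_wz : forall i, (i <= n)%N -> w i < z i.
  apply: (@down_ind _ m.+1) => i.
    by move=> /le_wx le_w /lt_xz; apply: le_lt_trans.
  rewrite ltnS => le_im /(_ (leq_ltn_trans le_im lt_mn)) lt_wz le_in.
  (* If ◊_m [y] agreed with [z] at [i], then [ell] would give [z i.+1 <= idia m y i.+1 <= w i.+1],
     against the strict inequality at [i.+1]. *)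
  have lt_pz : Order.max (x i) (idia m y i) < z i.
    rewrite gt_max lt_xz //= lt_neqAle [_ <= _](imeet_r _ _ i) andbT.
    apply: contraTneq lt_wz => Dz; rewrite -leNgt.
    apply: le_trans (ignatievP z i) _; rewrite -Dz /= idia_seqE // ell_add.
    exact: (imeet_r x (idia m y) i.+1).
  have lt_u := add_omega_lt (Order.max (x i) (idia m y i)) lt_wz.
  apply: le_lt_trans (lt_le_trans lt_u (add_omega_le lt_pz (ignatievP z i))).
  have le_pu := ltW (lt_add_omega (Order.max (x i) (idia m y i)) (w i.+1)).
  by apply: imeet_min; rewrite ?ell_add // (le_trans _ le_pu) // le_max lexx ?orbT.
apply: (@down_ind _ n.+1) => i /=; rewrite ?ltnS => lei; first by rewrite idia_seq0 ?le0e.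
move=> IHi; rewrite idia_seqE //; apply: add_omega_le (lt_wz _ lei) _.
exact: le_trans IHi (ignatievP z i).
Qed.

Lemma inabla_meet m n x y : (m < n)%N ->
  ile (imeet (inabla n x) (inabla m y)) (inabla n (imeet x (inabla m y))).
Proof.
move=> lt_mn; set z := imeet _ _; set w := imeet _ _.
have le_xz i : (i <= n)%N -> x i <= z i.
  move=> le_in; move: (imeet_l (inabla n x) (inabla m y) i).
  by rewrite /= /inabla_seq le_in.
suff le_wz : forall i, (i <= n)%N -> w i <= z i.
  by move=> i; rewrite /= /inabla_seq; case: ifP => [/le_wz|] // _; apply: le0e.
apply: (@down_ind _ m.+1) => i; rewrite ?ltnS => lei.
  move=> /le_xz; apply: le_trans; apply: imeet_tail lei => j lt_mj.
  by rewrite /= /inabla_seq leqNgt lt_mj.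
move=> /(_ (leq_ltn_trans lei lt_mn)) le_wz le_in; apply: imeet_min.
- exact: le_xz.
- exact: (imeet_r (inabla n x) (inabla m y) i).
- exact: le_trans le_wz (ignatievP z i).
Qed.

(** Derivations of variable-free sequents may pass through variables; with arbitrary valuations the
    substitution rule becomes a change of valuation. *)
Fixpoint valuation (v : nat -> ignatiev) (A : form) : ignatiev :=
  match A with
  | Var p => v p
  | Top => itop
  | And A B => imeet (valuation v A) (valuation v B)
  | Mod a A => imod a (valuation v A)
  end.

Lemma valuation_subst v s A :
  valuation v (form_subst s A) = valuation (fun p => valuation v (s p)) A.
Proof. by elim: A => //= [A -> B ->|a A ->]. Qed.

Lemma value_valuation A : value A = valuation (fun=> itop) A.
Proof. by elim: A => //= [A -> B ->|a A ->]. Qed.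

Lemma RCnabla_sound v A B : A ⊢ B -> ile (valuation v A) (valuation v B).
Proof.
move=> AB; elim: AB v => {A B} /=.
- by move=> A v; apply: ile_refl.
- by move=> A v i; apply: le0e.
- by move=> A B v; apply: imeet_l.
- by move=> A B v; apply: imeet_r.
- by move=> A B C _ IH1 _ IH2 v; apply: ile_trans (IH1 v) (IH2 v).
- by move=> A B C _ IH1 _ IH2 v; apply: imeet_glb.
- by move=> a A B _ IH v; apply: imod_mono.
- by move=> s A B _ IH v; rewrite !valuation_subst.
- case=> n A v /=; first exact: idia_idem.
  by move=> i; rewrite /= /inabla_seq; case: ifP.
- by move=> m n A lt_mn v; apply: idia_le_index (ltnW lt_mn).
- by move=> m n A B lt_mn v; apply: idia_meet.
- move=> m n A lt_mn v i; rewrite /= /inabla_seq; case: ifP => [le_im|_].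
    by rewrite (leq_trans le_im (ltnW lt_mn)).
  exact: le0e.
- by move=> m n A B lt_mn v; apply: inabla_meet.
- by move=> n A v i; rewrite /= /inabla_seq; case: ifP => // _; apply: le0e.
- by move=> n A v; apply: idia_nabla.
- by move=> m n A le_mn v; apply: idia_of_nabla.
- move=> m n A le_mn v i; rewrite /= /inabla_seq; case: leqP => // lt_ni.
  by rewrite idia_seq0 // (leq_ltn_trans le_mn).
Qed.

(** * Completeness *)

Lemma nabla_mono_index m n A : (m <= n)%N -> (∇[n] A)%rc ⊢ (∇[m] A)%rc.
Proof.
rewrite leq_eqVlt => /orP[/eqP->|]; [exact: RC_refl | exact: RC_nabla_le].
Qed.

Lemma dia_mono_index m n A : (m <= n)%N -> (◊[n] A)%rc ⊢ (◊[m] A)%rc.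
Proof.
rewrite leq_eqVlt => /orP[/eqP->|]; [exact: RC_refl | exact: RC_dia_le].
Qed.

Lemma mod_bind a A B C : C ⊢ Mod a A -> A ⊢ Mod a B -> C ⊢ Mod a B.
Proof.
move=> CA AB; apply: RC_trans (RC_trans CA (RC_mod a AB)) (RC_4 a B).
Qed.

Lemma and_mono A A' B B' : A ⊢ A' -> B ⊢ B' -> (A ∧ B)%rc ⊢ (A' ∧ B')%rc.
Proof.
move=> AA' BB'; apply: RC_and.
  exact: RC_trans (RC_andl A B) AA'.
exact: RC_trans (RC_andr A B) BB'.
Qed.

Lemma dia_and m n A B C : (m < n)%N ->
  C ⊢ (◊[n] A)%rc -> C ⊢ (◊[m] B)%rc -> C ⊢ (◊[n] (A ∧ ◊[m] B))%rc.
Proof.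
move=> lt_mn CA CB; exact: RC_trans (RC_and CA CB) (RC_dia_and _ _ lt_mn).
Qed.

Lemma nabla_and m n A B C : (m < n)%N ->
  C ⊢ (∇[n] A)%rc -> C ⊢ (∇[m] B)%rc -> C ⊢ (∇[n] (A ∧ ∇[m] B))%rc.
Proof.
move=> lt_mn CA CB; exact: RC_trans (RC_and CA CB) (RC_nabla_and _ _ lt_mn).
Qed.

(** No axiom moves ◊_m under ∇_n directly, but ◊_m B is equivalent to ∇_m ◊_m B, which reduces this
    to [nabla_and]. *)
Lemma nabla_and_dia m n A B C : (m < n)%N ->
  C ⊢ (∇[n] A)%rc -> C ⊢ (◊[m] B)%rc -> C ⊢ (∇[n] (A ∧ ◊[m] B))%rc.
Proof.
move=> lt_mn CA CB.
apply: RC_trans (nabla_and lt_mn CA (RC_trans CB (RC_nabla m _))) (RC_mod _ _).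
exact: and_mono (RC_refl A) (RC_nabla_of_dia _ (leqnn m)).
Qed.

(** * Worms of ordinals *)

(* [worm n x Top] has the ordinal [x] as the [n]-th component of its value:   *)
(* each step adds [omega^a], the leading summand first, because d + omega^a   *)
(* is the least ordinal above d whose [ell] is at least [a].                  *)
Fixpoint worm (n : nat) (x : cnf) (D : form) : form :=
  if x is CW a b then worm n b (worm n.+1 a Top ∧ ◊[n] D)%rc else D.

Lemma worm_dia n x D : x != C0 -> worm n x D ⊢ (◊[n] D)%rc.
Proof.
elim: x D => // a _ b IHb D _ /=.
case: (eqVneq b C0) => [->|/IHb bD]; first exact: RC_andr.
exact: mod_bind (bD _) (RC_andr _ _).
Qed.

Lemma dia_worm n x D : (◊[n] (worm n x D))%rc ⊢ (◊[n] D)%rc.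
Proof.
case: (eqVneq x C0) => [->|nz_x]; first exact: RC_refl.
exact: mod_bind (RC_refl _) (worm_dia n D nz_x).
Qed.

(** Common leading summands are absorbed into [D]. Where the exponents first differ, the worm of the
    larger exponent [a] proves ◊_(n+1) of the worm of any smaller one; ◊_n [D'] moves under that
    diamond, so all summands of [z], having exponents below [a], can be added one by one. *)
Lemma worm_lt n x y D : nf y -> y < x -> worm n x D ⊢ (◊[n] (worm n y D))%rc.
Proof.
elim: x n y D => [|a IHa b IHb] n [|c d] D // nf_y; first by move=> _; apply: worm_dia.
rewrite cnf_ltE /= -!cnf_ltE => /orP[lt_ca|/andP[/eqP-> lt_db]]; last first.
  by apply: IHb lt_db; move: nf_y; rewrite nf_CW => /and3P[].
have {}IHa z D' : nf z -> (z == C0) || (lead z < a) ->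
    (worm n.+1 a Top ∧ ◊[n] D')%rc ⊢ (◊[n] (worm n z D'))%rc.
  elim: z D' => [|e _ f IHf] D'; first by move=> _ _; apply: RC_andr.
  rewrite nf_CW => /and3P[nf_e nf_f le_fe] /= lt_ea.
  apply: RC_trans (RC_and (RC_andl _ _) _) (IHf _ nf_f _); last first.
    by rewrite (le_lt_trans le_fe lt_ea) orbT.
  apply: RC_trans _ (dia_mono_index _ (leqnSn n)); apply: dia_and => //.
    exact: RC_trans (RC_andl _ _) (IHa _ _ _ nf_e lt_ea).
  exact: RC_andr.
case: (eqVneq b C0) => [->|nz_b]; first exact: (IHa (CW c d)).
by apply: mod_bind (worm_dia _ _ nz_b) (IHa _ _ nf_y _).
Qed.

(** Absorption of small summands by ω^e is matched by [dia_worm], which discards their worm under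
    ◊_n. *)
Lemma worm_add_omega n x e D :
  (worm n.+1 e Top ∧ ◊[n] (worm n x D))%rc ⊢ worm n (cnf_add x (CW e C0)) D.
Proof.
elim: x D => [|a _ b IHb] D; first exact: RC_refl.
rewrite [cnf_add _ _]/=; case: (ltP a e) => _ /=; last exact: IHb.
exact: and_mono (RC_refl _) (dia_worm n (CW a b) D).
Qed.

Lemma worm_ell n x D : worm n x D ⊢ worm n.+1 (cnf_ell x) Top.
Proof.
case: x => [|a b]; first exact: RC_top.
elim: b a D => [|c _ d IHd] a D; first exact: RC_andl.
exact: IHd.
Qed.

(* The summands of [x] below omega^e are dropped: they leave a [◊[n]] of the  *)
(* truncated worm, which no longer depends on them and is [∇[n]]-stable.      *)
Lemma nabla_worm_up n e x C :
  C ⊢ (∇[n.+1] (worm n.+1 e Top))%rc -> C ⊢ (∇[n] (worm n x Top))%rc ->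
  C ⊢ (∇[n] (worm n (cnf_up e x) Top))%rc.
Proof.
move=> Ce Cx; rewrite /cnf_up; case: (eqVneq e C0) => // nz_e.
have up D : C ⊢ (◊[n] D)%rc -> C ⊢ (∇[n] (worm n (CW e C0) D))%rc.
  move=> CD; apply: RC_trans _ (nabla_mono_index _ (leqnSn n)).
  exact: nabla_and_dia.
case: eqP => _.
  (* With [x] zero, the required ◊_n Top comes from the worm of the nonzero [e]. *)
  apply: RC_trans (RC_trans Ce (nabla_mono_index _ (leqnSn n))) (RC_mod _ _).
  apply: RC_and; first exact: RC_refl.
  exact: RC_trans (worm_dia _ _ nz_e) (dia_mono_index _ (leqnSn n)).
elim: x Top Cx => // a _ b IHb D CD.
rewrite [cnf_up_tail _ _]/=; case: ifP => _; first exact: IHb.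
apply: up; apply: RC_trans CD (RC_trans (RC_mod _ (worm_dia _ _ _)) _) => //.
exact: RC_nabla_of_dia.
Qed.

(** * Component formulas and their finite conjunctions *)

Definition comp_form (i : nat) (a : eps0) : form := (∇[i] (worm i a Top))%rc.

Lemma comp_form_mono i (a b : eps0) : a <= b -> comp_form i b ⊢ comp_form i a.
Proof.
rewrite le_eqVlt => /orP[/eqP->|lt_ab]; first exact: RC_refl.
apply: mod_bind (RC_refl _) (RC_trans (worm_lt _ _ (valP a) lt_ab) _).
exact: RC_dia_nabla.
Qed.

Lemma comp_form0 i C : C ⊢ comp_form i eps0_zero.
Proof. exact: RC_trans (RC_top C) (RC_nabla i Top). Qed.

Lemma comp_form_dia i (a b : eps0) C :
  a < b -> C ⊢ comp_form i b -> C ⊢ (◊[i] (worm i a Top))%rc.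
Proof.
move=> lt_ab Cb; apply: RC_trans Cb (RC_trans (RC_mod _ _) _).
  exact: worm_lt _ _ (valP a) lt_ab.
exact: RC_nabla_of_dia.
Qed.

Fixpoint seq_form (x : nat -> eps0) (i k : nat) : form :=
  if k is k'.+1 then (comp_form i (x i) ∧ seq_form x i.+1 k')%rc else Top.

Lemma seq_form_intro x i k C :
  (forall j, (i <= j < i + k)%N -> C ⊢ comp_form j (x j)) -> C ⊢ seq_form x i k.
Proof.
elim: k i => [|k IHk] i Cx /=; first exact: RC_top.
apply: RC_and; first by apply: Cx; rewrite leqnn -addSnnS leq_addr.
by apply: IHk => j /andP[lt_ij lt_j]; apply: Cx; rewrite (ltnW lt_ij) -addSnnS.
Qed.

Lemma seq_form_elim x i k j :
  (i <= j < i + k)%N -> seq_form x i k ⊢ comp_form j (x j).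
Proof.
elim: k i => [|k IHk] i.
  by rewrite addn0 => /andP[/leq_ltn_trans lt_ij /lt_ij]; rewrite ltnn.
rewrite -addSnnS leq_eqVlt /= => /andP[/predU1P[->|lt_ij] lt_j].
  exact: RC_andl.
by apply: RC_trans (RC_andr _ _) (IHk _ _); rewrite lt_ij.
Qed.

Lemma seq_form_le x i k l : (k <= l)%N -> seq_form x i l ⊢ seq_form x i k.
Proof.
move=> le_kl; apply: seq_form_intro => j /andP[le_ij lt_j].
by apply: seq_form_elim; rewrite le_ij (leq_trans lt_j) // leq_add2l.
Qed.

(* As [ell] is not monotone, the value of the worm of [x i] need not dominate *)
(* [x] beyond component [i.+1], so [ell (x i)] has to be weakened to [x i.+1] *)
(* under a [∇[i.+1]] before descending further.                               *)
Lemma comp_form_seq (x : ignatiev) i k :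
  comp_form i (x i) ⊢ (∇[i] (seq_form x i k))%rc.
Proof.
elim: k i => [|k IHk] i /=; first exact: RC_trans (RC_top _) (RC_nabla i Top).
apply: mod_bind (RC_refl _) _.
have next : worm i (x i) Top ⊢ (∇[i.+1] (seq_form x i.+1 k))%rc.
  apply: RC_trans (worm_ell _ _ _) (RC_trans (RC_nabla i.+1 _) _).
  exact: RC_trans (comp_form_mono i.+1 (ignatievP x i)) (IHk i.+1).
apply: RC_trans (nabla_and (ltnSn i) next (RC_nabla i _)) _.
apply: RC_trans (nabla_mono_index _ (leqnSn i)) (RC_mod _ _).
exact: RC_and (RC_andr _ _) (RC_andl _ _).
Qed.

(** Components beyond [n] come from the [n]-th one by [comp_form_seq]; those below [n] move under
    ∇_n one at a time. *)
Lemma nabla_seq_form (x : ignatiev) n k C :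
  (forall i, (i <= n)%N -> C ⊢ comp_form i (x i)) ->
  C ⊢ (∇[n] (seq_form x 0 (n + k)))%rc.
Proof.
move=> Cx; suff H j i : (i + j)%N = n -> C ⊢ (∇[n] (seq_form x i (j + k)))%rc.
  exact: H.
elim: j i => [|j IHj] i Dn.
  by rewrite addn0 in Dn; rewrite Dn; apply: RC_trans (Cx n _) (comp_form_seq _ _ _).
have lt_in : (i < n)%N by rewrite -Dn -addSnnS leq_addr.
apply: RC_trans (nabla_and lt_in (IHj i.+1 _) (Cx i (ltnW lt_in))) (RC_mod _ _).
  by rewrite addSnnS.
exact: RC_and (RC_andr _ _) (RC_andl _ _).
Qed.

(** Same descent with diamonds: each ◊_i moves under ◊_n and is weakened there to ∇_i. At [n]
    itself, ◊_n ∇_n collapses to ◊_n. *)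
Lemma dia_seq_form (x : ignatiev) n k C :
  (forall i, (i <= n)%N -> C ⊢ (◊[i] (worm i (x i) Top))%rc) ->
  C ⊢ (◊[n] (seq_form x 0 (n + k)))%rc.
Proof.
move=> Cx; suff H j i : (i + j)%N = n -> C ⊢ (◊[n] (seq_form x i (j + k)))%rc.
  exact: H.
elim: j i => [|j IHj] i Dn.
  rewrite addn0 in Dn; rewrite Dn; apply: RC_trans (Cx n _) _ => //.
  apply: RC_trans (RC_mod _ _) (RC_dia_of_nabla _ (leqnn n)).
  exact: RC_trans (RC_nabla n _) (comp_form_seq _ _ _).
have lt_in : (i < n)%N by rewrite -Dn -addSnnS leq_addr.
apply: RC_trans (dia_and lt_in (IHj i.+1 _) (Cx i (ltnW lt_in))) (RC_mod _ _).
  by rewrite addSnnS.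
apply: RC_and (RC_andl _ _); apply: RC_trans (RC_andr _ _) _.
exact: RC_dia_nabla.
Qed.

(** * Equivalence of a formula with the components of its value *)

Lemma derives_meet (x y : ignatiev) C :
  (forall i, C ⊢ comp_form i (x i)) -> (forall i, C ⊢ comp_form i (y i)) ->
  forall i, C ⊢ comp_form i (imeet x y i).
Proof.
move=> Cx Cy; set w := imeet x y.
apply: (@down_ind _ (cnf_height (w 0%N))) => i.
  by move=> le_i; rewrite ignatiev_eq0 //; apply: comp_form0.
move=> _ Cw; pose m := Order.max (x i) (y i).
(* By minimality of the meet and [comp_form_mono], the ordinal produced by [nabla_worm_up]
   suffices. *)
have le_wu : w i <= ord_up (w i.+1) m.
  have le_mu : m <= ord_up (w i.+1) m by apply: cnf_up_ge.
  apply: imeet_min; last exact: cnf_up_ell.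
    by apply: le_trans le_mu; rewrite le_max lexx.
  by apply: le_trans le_mu; rewrite le_max lexx orbT.
apply: RC_trans _ (comp_form_mono i le_wu); apply: nabla_worm_up => //.
by rewrite /m; case: leP => _; [apply: Cy | apply: Cx].
Qed.

Lemma derives_dia n (x : ignatiev) C :
  (forall i, C ⊢ comp_form i (x i)) ->
  forall i, (◊[n] C)%rc ⊢ comp_form i (idia n x i).
Proof.
(* The bare worm is proved instead of its ∇_i, since [worm_add_omega] needs the worm at [i.+1]
   without a modality. *)
move=> Cx i; apply: RC_trans _ (RC_nabla i _); move: i.
apply: (@down_ind _ n.+1) => i /=; rewrite ?ltnS => lei.
  by rewrite idia_seq0 //; apply: RC_top.
move=> IHi; rewrite idia_seqE //.
apply: RC_trans (RC_and IHi _) (worm_add_omega _ _ _ _).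
apply: RC_trans (dia_mono_index _ lei) (RC_trans (RC_mod _ (Cx i)) _).
exact: RC_dia_of_nabla.
Qed.

Lemma derives_nabla n (x : ignatiev) C :
  (forall i, C ⊢ comp_form i (x i)) ->
  forall i, (∇[n] C)%rc ⊢ comp_form i (inabla n x i).
Proof.
move=> Cx i; rewrite /= /inabla_seq; case: ifP => [le_in|_]; last exact: comp_form0.
apply: mod_bind (Cx i); exact: nabla_mono_index.
Qed.

Lemma derives_value A : variable_free A -> forall i, A ⊢ comp_form i (value A i).
Proof.
elim: A => //= [_ i|A IHA B IHB /andP[/IHA{}IHA /IHB{}IHB]|[]n A IHA /IHA{}IHA].
- exact: comp_form0.
- apply: derives_meet => i.
    exact: RC_trans (RC_andl A B) (IHA i).
  exact: RC_trans (RC_andr A B) (IHB i).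
- exact: derives_dia.
- exact: derives_nabla.
Qed.

Lemma value_derives A :
  variable_free A -> exists k, seq_form (value A) 0 k ⊢ A.
Proof.
elim: A => //= [_|A IHA B IHB /andP[/IHA{IHA}[k kA] /IHB{IHB}[l lB]]
  |[]n A IHA /IHA{IHA}[k kA]].
- by exists 0%N; apply: RC_refl.
- exists (k + l)%N; apply: RC_and.
    apply: RC_trans (seq_form_intro _) kA => j /= lt_jk.
    apply: RC_trans (seq_form_elim _ _) (comp_form_mono _ (imeet_l _ _ j)).
    exact: leq_trans lt_jk (leq_addr _ _).
  apply: RC_trans (seq_form_intro _) lB => j /= lt_jl.
  apply: RC_trans (seq_form_elim _ _) (comp_form_mono _ (imeet_r _ _ j)).
  exact: leq_trans lt_jl (leq_addl _ _).
(* Components 0 to [n] suffice. Each strictly exceeds that of [value A], so [comp_form_dia] yields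
   the diamonds that [dia_seq_form] needs. *)
- exists n.+1.
  have sub := RC_trans (seq_form_le _ 0 (leq_addl n k)) kA.
  apply: RC_trans (dia_seq_form k _) (RC_mod _ sub) => i le_in.
  by apply: comp_form_dia (idia_gt _ le_in) (seq_form_elim _ _).
- exists n.+1.
  have sub := RC_trans (seq_form_le _ 0 (leq_addl n k)) kA.
  apply: RC_trans (nabla_seq_form k _) (RC_mod _ sub) => i le_in.
  by have := @seq_form_elim (inabla_seq n (value A)) 0 n.+1 i le_in;
    rewrite /inabla_seq le_in.
Qed.

Theorem theorem10 (A B : form) :
  variable_free A -> variable_free B ->
  RCnabla A B <-> ile (value A) (value B).
Proof.
move=> freeA freeB; split=> [AB|le_AB].
  by rewrite !value_valuation; apply: RCnabla_sound.
have [k kB] := value_derives freeB.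
apply: RC_trans (seq_form_intro _) kB => i _.
exact: RC_trans (derives_value freeA i) (comp_form_mono i (le_AB i)).
Qed.
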